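(* Let $G$ be a finite connected undirected graph (multiple edges and loops allowed) with $n=|V(G)|$ vertices. The number of partial orientations of $G$ modulo cut reversals, i.e. the number of equivalence classes of partial orientations of $G$ under the equivalence relation generated by cut reversals, is $2^{n-1}\,T_G(1,3)$, where $T_G(x,y)$ is the Tutte polynomial of $G$.
   Context: A partial orientation of $G$ is an orientation of a subset of the edges; the remaining edges are unoriented (each edge, including each loop, has two possible orientations or is unoriented). A directed cut in a partial orientation is the set of all edges between $X$ and $X^c=V(G)\setminus X$, for some $\emptyset\neq X\subsetneq V(G)$, such that every one of these edges is oriented, and all are oriented from $X$ to $X^c$. A cut reversal reverses the orientation of all edges in a directed cut. *)

(* Defs.v *)
From HB Require Import structures.
From mathcomp Require Import all_boot all_order all_algebra.
Set Implicit Arguments.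
Unset Strict Implicit.
Unset Printing Implicit Defensive.
Import GRing.Theory.
Local Open Scope ring_scope.

(* An undirected multigraph: parallel edges and loops are allowed.  The order
   of the two ends of an edge carries no meaning in the graph itself; it only
   serves to name the two orientations of the edge (also when it is a loop). *)
Record mgraph := MGraph {
  vert : finType;
  edge : finType;
  ends : edge -> vert * vert
}.

Definition adjacent (G : mgraph) (A : {set edge G}) : rel (vert G) :=
  [rel u v | [exists e in A, (ends e == (u, v)) || (ends e == (v, u))]].

Definition connected_graph (G : mgraph) : Prop :=
  (0 < #|vert G|)%N /\ forall u v : vert G, connect (adjacent setT) u v.

(* None: the edge is unoriented; Some false: it is oriented from (ends e).1
   to (ends e).2; Some true: from (ends e).2 to (ends e).1. *)
Definition porientation (G : mgraph) := {ffun edge G -> option bool}.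

Definition tail (G : mgraph) (e : edge G) (b : bool) : vert G :=
  if b then (ends e).2 else (ends e).1.

Definition head (G : mgraph) (e : edge G) (b : bool) : vert G :=
  tail e (~~ b).

Definition cut (G : mgraph) (X : {set vert G}) : {set edge G} :=
  [set e | ((ends e).1 \in X) (+) ((ends e).2 \in X)].

Definition directed_from (G : mgraph) (o : porientation G) (X : {set vert G})
    (e : edge G) : bool :=
  if o e is Some b then (tail e b \in X) && (head e b \notin X) else false.

Definition directed_cut (G : mgraph) (o : porientation G) (X : {set vert G}) :=
  [&& X != set0, X \proper setT & [forall e in cut X, directed_from o X e]].

Definition reverse_on (G : mgraph) (o : porientation G) (C : {set edge G}) :
    porientation G :=
  [ffun e => if e \in C then omap negb (o e) else o e].

Definition cut_reversal (G : mgraph) : rel (porientation G) :=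
  [rel o p | [exists X, directed_cut o X && (p == reverse_on o (cut X))]].

Definition cut_equiv (G : mgraph) : rel (porientation G) :=
  connect [rel o p | cut_reversal o p || cut_reversal p o].

Definition cut_classes (G : mgraph) : {set {set porientation G}} :=
  equivalence_partition (@cut_equiv G) [set: porientation G].

(* #|V| minus the number of connected components of the subgraph (V, A). *)
Definition edge_rank (G : mgraph) (A : {set edge G}) : nat :=
  #|vert G| - n_comp (adjacent A) (vert G).

(* A polynomial in y ('X) over the polynomials in x ('X%:P). *)
Definition tutte (G : mgraph) : {poly {poly int}} :=
  \sum_(A : {set edge G})
     ('X%:P - 1) ^+ (edge_rank [set: edge G] - edge_rank A)
     * ('X - 1) ^+ (#|A| - edge_rank A).

Definition tutte_eval (G : mgraph) (x y : int) : int := (tutte G).[y%:P].[x].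

(* Main.v *)
Require Import Defs.
From mathcomp Require Import all_boot all_order all_algebra.
From mathcomp Require Import zify.
Import Defs Order.TTheory GRing.Theory Num.Theory.
Local Open Scope ring_scope.

(** Fix a root vertex q.  Call a partial orientation root-connected when every
    vertex can be reached from q by traversing oriented edges forwards and
    unoriented edges in both ways.  The theorem is the conjunction of three
    facts.

    Each class of cut reversals contains exactly one root-connected member.
    For existence ([root_connected_exists]): the edges between the vertices
    that q reaches and the others all point towards the reached side, so they
    form a directed cut, and reversing it makes q reach strictly more.  For
    uniqueness ([root_connected_unique]): a chain of cut reversals from o to p
    changes the orientations by the coboundary of an integer potential on the
    vertices, namely the sum of the signed indicators of the sets used.  If the
    potential is not constant, the set X where it is maximal is entered by no
    traversable edge in o and left by none in p; root-connectedness of o puts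
    q inside X, that of p puts q outside, which is absurd.

    There are as many root-connected partial orientations as partial
    orientations whose oriented edges connect the whole graph
    ([card_explorations]).  Explore the graph from q.  Each time an edge that
    leaves the explored set is inspected, exactly two of its three states let
    the exploration pass, both when one may traverse the unoriented edges and
    those oriented outwards, and when one may traverse exactly the oriented
    edges.  The next step depends only on whether the exploration passed, so
    the two rules give the same number of successful configurations.

    Finally a set A of edges is the support of 2 ^ |A| partial orientations,
    and in T(1, y) only the connected spanning A survive, each contributing
    (y - 1) ^ (|A| - n + 1); for y = 3 the factor 2 ^ (n - 1) turns this into
    2 ^ |A| ([tutte_spanning]). *)

(** * Sets stable under traversable arcs *)

(** The relation a tells which edges may be traversed in which direction,
    the direction b going from [tail e b] to [head e b].  Both orientations and
    undirected subgraphs are instances. *)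
Definition stable {G : mgraph} (a : edge G -> bool -> bool)
    (S : {set vert G}) : bool :=
  [forall e, forall b, a e b ==> (tail e b \in S) ==> (head e b \in S)].

(** Every vertex can be reached from R.  Quantifying over stable sets instead of
    paths makes the removal of one edge, and the arguments by cuts, immediate. *)
Definition spans {G : mgraph} (a : edge G -> bool -> bool)
    (R : {set vert G}) : bool :=
  [forall S : {set vert G}, (R \subset S) ==> stable a S ==> (S == setT)].

Lemma stableP {G : mgraph} {a : edge G -> bool -> bool} {S : {set vert G}} :
  reflect (forall e b, a e b -> tail e b \in S -> head e b \in S) (stable a S).
Proof.
apply: (iffP forallP) => [H e b ae te|H e].
  by have /forallP/(_ b) := H e; rewrite ae te.
by apply/forallP => b; apply/implyP => ae; apply/implyP; apply: H.
Qed.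

Lemma spansP {G : mgraph} {a : edge G -> bool -> bool} {R : {set vert G}} :
  reflect (forall S : {set vert G}, R \subset S -> stable a S -> S = setT)
          (spans a R).
Proof.
apply: (iffP forallP) => [H S RS aS|H S].
  by have := H S; rewrite RS aS => /eqP.
by apply/implyP => RS; apply/implyP => aS; apply/eqP/H.
Qed.

Lemma eq_spans {G : mgraph} (a a' : edge G -> bool -> bool)
    (R : {set vert G}) :
  a =2 a' -> spans a R = spans a' R.
Proof.
move=> eqa; apply: eq_forallb => S; congr (_ ==> (_ ==> _)).
by apply: eq_forallb => e; apply: eq_forallb => b; rewrite eqa.
Qed.

Lemma headN {G : mgraph} (e : edge G) b : head e (~~ b) = tail e b.
Proof. by rewrite /head negbK. Qed.

Lemma tailN {G : mgraph} (e : edge G) b : tail e (~~ b) = head e b.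
Proof. by []. Qed.

(** One step of exploration: once an edge leaving R is inspected it can be
    deleted, since its reverse direction only leads back into R. *)
Lemma spans_explore {G : mgraph} (a : edge G -> bool -> bool)
    (R : {set vert G}) (e : edge G) (b : bool) :
  tail e b \in R ->
  spans a R = spans (fun e' c => (e' != e) && a e' c)
                    (if a e b then head e b |: R else R).
Proof.
move=> teR; apply/spansP/spansP => H S RS /stableP aS; apply: H.
- by case: (a e b) RS; rewrite // subUset => /andP[].
- apply/stableP => e' c ae' te'; have [Ee|ne] := eqVneq e' e; last first.
    by apply: (aS e' c) => //; rewrite ne.
  rewrite {}Ee in ae' te' *; have [Ec|nc] := eqVneq c b.
    by move: RS; rewrite -Ec ae' subUset sub1set => /andP[].
  have -> : c = ~~ b by case: c b nc {ae' te' teR RS aS} => [] [].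
  rewrite headN.
  by move: RS; case: (a e b); rewrite ?subUset => RS;
    [case/andP: RS => _ RS|]; apply: (subsetP RS).
- case: ifP => // aeb; rewrite subUset RS sub1set andbT.
  exact: (aS e b aeb (subsetP RS _ teR)).
- by apply/stableP => e' c /andP[_]; apply: aS.
Qed.

Lemma spans_sealed {G : mgraph} (a : edge G -> bool -> bool)
    (R : {set vert G}) :
  (forall e b, a e b -> tail e b \in R -> head e b \in R) ->
  spans a R = (R == setT).
Proof.
move=> aR; apply/spansP/eqP => [H|-> S]; last by rewrite subTset => /eqP.
by apply: H => //; apply/stableP.
Qed.

(** The dichotomy that drives the exploration.  It ignores the states of the
    edges, so the edge inspected next is the same for all configurations. *)
Lemma sealed_or_exit {G : mgraph} (A : {set edge G}) (R : {set vert G}) :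
  (forall e b, e \in A -> tail e b \in R -> head e b \in R)
  \/ exists e b, [/\ e \in A, tail e b \in R & head e b \notin R].
Proof.
have [/stableP|] := boolP (stable (fun e _ => e \in A) R); first by left.
rewrite negb_forall => /existsP[e]; rewrite negb_forall => /existsP[b].
by rewrite !negb_imply => /and3P[eA te he]; right; exists e, b.
Qed.

(** Each inspected edge adds at most one vertex to the explored set.  For a
    single root this is the bound |V| - 1 <= |A| for a connected graph. *)
Lemma card_spanning {G : mgraph} (A : {set edge G}) (R : {set vert G}) :
  spans (fun e _ => e \in A) R -> (#|~: R| <= #|A|)%N.
Proof.
move Em : #|A| => m; elim: m A R Em => [|m IH] A R Em sp.
  have /eqP RT : R == setT.
    rewrite -(@spans_sealed _ (fun e _ => e \in A)) // => e b.
    by rewrite (cards0_eq Em) inE.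
  by rewrite RT setCT cards0.
have [sealed|[e [b [eA teR heR]]]] := sealed_or_exit A R.
  by move: sp; rewrite spans_sealed // => /eqP->; rewrite setCT cards0.
move: sp; rewrite (spans_explore _ _ e b teR) eA => sp.
have /IH : #|A :\ e| = m by move: Em; rewrite (cardsD1 e A) eA => -[].
move=> /(_ (head e b |: R)); rewrite setCU => H.
have -> : #|~: R| = #|~: [set head e b] :&: ~: R|.+1.
  rewrite (cardsD1 (head e b) (~: R)) inE heR add1n; congr _.+1.
  by apply: eq_card => x; rewrite !inE.
apply: H; move: sp; rewrite (@eq_spans _ _ (fun e' _ => e' \in A :\ e)) //.
by move=> e' c; rewrite !inE.
Qed.

(** * Counting successful explorations *)

Lemma card_family_const {E T : finType} (A : {set E}) (F : E -> pred T)
    (k : nat) :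
  (forall e, #|F e| = if e \in A then k else 1%N) -> #|family F| = (k ^ #|A|)%N.
Proof.
move=> FA; rewrite card_family /image_mem foldrE big_map big_enum /=.
by rewrite (eq_bigr _ (fun e _ => FA e)) -big_mkcond prod_nat_const.
Qed.

(** Configurations of edge states for which R reaches everything through A, where
    t b is the set of states that let one pass in direction b.  The states
    outside A are frozen to those of g, so that inspecting an edge amounts to
    moving it out of A and summing over its possible states. *)
Definition explorations {G : mgraph} {T : finType} (t : bool -> pred T)
    (A : {set edge G}) (R : {set vert G}) (g : {ffun edge G -> T}) :
    {set {ffun edge G -> T}} :=
  [set f : {ffun edge G -> T} |
    [forall e, (e \notin A) ==> (f e == g e)]
    && spans (fun e b => (e \in A) && t b (f e)) R].

Lemma card_agree {E T : finType} (A : {set E}) (g : {ffun E -> T}) :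
  #|[set f : {ffun E -> T} | [forall e, (e \notin A) ==> (f e == g e)]]|
  = (#|T| ^ #|A|)%N.
Proof.
pose F e : pred T := if e \in A then predT else pred1 (g e).
rewrite -(card_family_const A F) => [|e]; last first.
  by rewrite /F; case: (e \in A); rewrite ?card1.
rewrite cardsE; apply: eq_card => f; rewrite inE /=.
by apply: eq_forallb => e; rewrite /F; case: (e \in A).
Qed.

Definition update {E : finType} {T : Type} (g : {ffun E -> T}) (e : E) (s : T) :
  {ffun E -> T} := [ffun x => if x == e then s else g x].

Lemma card_explorations_step {G : mgraph} {T : finType} (t : bool -> pred T)
    (A : {set edge G}) (R : {set vert G}) (g : {ffun edge G -> T}) e b :
  e \in A -> tail e b \in R ->
  #|explorations t A R g| =
  (\sum_s #|explorations t (A :\ e) (if t b s then head e b |: R else R)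
                         (update g e s)|)%N.
Proof.
move=> eA teR; rewrite -sum1_card.
rewrite (partition_big (fun f : {ffun edge G -> T} => f e) predT) //=.
apply: eq_bigr => s _; rewrite -sum1_card; apply: eq_bigl => f; rewrite !inE.
rewrite -andbA andbCA (spans_explore _ _ e b teR) eA /=.
have -> : [forall x, (x \notin A :\ e) ==> (f x == update g e s x)] =
   [forall x, (x \notin A) ==> (f x == g x)] && (f e == s).
  apply/forallP/andP => [H|[/forallP H /eqP fe] x].
    split; last by have := H e; rewrite !inE eqxx ffunE eqxx.
    apply/forallP => x; apply/implyP => xA; have := H x.
    rewrite !inE (negbTE xA) andbF ffunE /=.
    by case: (x =P e) xA => // ->; rewrite eA.
  rewrite !inE ffunE negb_and negbK; case: (x =P e) => [->|_] /=; first exact/eqP.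
  exact: H.
rewrite andbC -andbA; case: (f e =P s) => [<-|_]; last by rewrite andbF.
rewrite andbT /=; congr (_ && _); apply: eq_spans => x c.
by rewrite in_setD1 andbA.
Qed.

(** The number of successful configurations depends on the rule t only through
    the number of passing states in each direction. *)
Lemma card_explorations {G : mgraph} {T : finType} (k : bool -> nat)
    (A : {set edge G}) (R : {set vert G}) :
  exists c : nat, forall t : bool -> pred T, (forall b, #|t b| = k b) ->
    forall g : {ffun edge G -> T}, #|explorations t A R g| = c.
Proof.
move Em : #|A| => m; elim: m A R Em => [|m IH] A R Em;
  have [sealed|[e [b [eA teR heR]]]] := sealed_or_exit A R.
1,3: exists (if R == setT then #|T| ^ #|A| else 0)%N => t _ g;
  have aR f : spans (fun e b => (e \in A) && t b (f e)) R = (R == setT) by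
    [apply: spans_sealed => e b /andP[+ _]; apply: sealed];
  rewrite /explorations; under eq_finset => f do rewrite aR;
  case: (R == setT); [under eq_finset => f do rewrite andbT|];
  rewrite ?card_agree //; apply: eq_card0 => f; rewrite inE andbF //.
  by rewrite (cards0_eq Em) inE in eA.
have EA : #|A :\ e| = m by move: Em; rewrite (cardsD1 e A) eA => -[].
have [c1 H1] := IH _ (head e b |: R) EA; have [c0 H0] := IH _ R EA.
exists (k b * c1 + (#|T| - k b) * c0)%N => t kt g.
rewrite (card_explorations_step _ _ _ _ e b) // (bigID (t b)) /=.
rewrite (eq_bigr (fun=> c1)) => [|s ->]; last exact: H1.
rewrite [X in (_ + X)%N](eq_bigr (fun=> c0)) => [|s /negbTE->]; last exact: H0.
by rewrite !sum_nat_const -(cardC (t b)) !kt addKn.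
Qed.

(** * Root-connected representatives of the cut classes *)

(** An unoriented edge can be traversed in both directions. *)
Definition open_arc {G : mgraph} (o : porientation G) (e : edge G) (b : bool) :=
  o e != Some (~~ b).

Lemma cutP {G : mgraph} {X : {set vert G}} {e : edge G} :
  reflect (exists b, tail e b \in X /\ head e b \notin X) (e \in cut X).
Proof.
rewrite inE; apply: (iffP idP) => [|[b []]]; last first.
  by case: b; rewrite /head /tail /= => -> /negbTE->.
by case E1: (_ \in X); case E2: (_ \in X) => // _;
  [exists false|exists true]; rewrite /head /tail /= E1 E2.
Qed.

(** The differences between p and o form the coboundary of h.  Counting the
    blocked directions one at a time also records that o and p have the same
    unoriented edges: add the equations for b and ~~ b. *)
Definition potential_diff {G : mgraph} (o p : porientation G)
    (h : vert G -> int) :=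
  forall e b, (p e == Some (~~ b))%:Z - (o e == Some (~~ b))%:Z
              = h (tail e b) - h (head e b).

(** The potential is the indicator of the side from which the cut points away. *)
Lemma cut_reversal_potential {G : mgraph} (o p : porientation G) :
  cut_reversal o p -> exists h, potential_diff o p h.
Proof.
case/existsP => X /andP[/and3P[_ _ /forallP dX] /eqP->].
exists (fun v => (v \in X)%:Z) => e b; rewrite ffunE.
have := dX e; case: ifPn => [_|eX _] /=.
  rewrite /directed_from; case: (o e) => // c /andP[] /=.
  by case: b c => [] [] /=; rewrite /head /tail /= => -> /negbTE->.
suff -> : (tail e b \in X) = (head e b \in X) by rewrite !subrr.
apply/idP/idP => H; apply: contraNT eX => H'; apply/cutP; first by exists b.
by exists (~~ b); rewrite headN.
Qed.

Lemma cut_equiv_potential {G : mgraph} (o p : porientation G) :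
  cut_equiv o p -> exists h, potential_diff o p h.
Proof.
case/connectP => s; elim: s o => [|o' s IH] o /=.
  by move=> _ ->; exists (fun=> 0) => e b; rewrite !subrr.
case/andP => oo' /IH{}IH /IH[h Hh].
have [k Hk] : exists k, potential_diff o o' k.
  case/orP: oo' => /cut_reversal_potential[k Hk]; first by exists k.
  by exists (fun v => - k v) => e b; have := Hk e b; lia.
by exists (fun v => h v + k v) => e b; have := Hk e b; have := Hh e b; lia.
Qed.

(** The set X where the potential is maximal is stable for p, and its complement
    is stable for o: an arc leaving X in p, or entering X in o, would make the
    two sides of [potential_diff] have incompatible signs. *)
Lemma root_connected_unique {G : mgraph} (q : vert G) (o p : porientation G) :
  spans (open_arc o) [set q] -> spans (open_arc p) [set q] ->
  cut_equiv o p -> o = p.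
Proof.
move=> /spansP so /spansP sp /cut_equiv_potential[h Hh].
have [x _ hx] := @arg_maxP _ _ _ q predT h isT.
pose X := [set v | h v == h x].
have lth v : v \notin X -> h v < h x by rewrite inE lt_neqAle => ->; apply: hx.
have XT : X = setT.
  have [qX|qX] := boolP (q \in X).
    apply: sp; first by rewrite sub1set.
    apply/stableP => e b op; rewrite inE => /eqP te.
    apply/negPn/negP => /lth hd.
    by have := Hh e b; rewrite (negbTE op); lia.
  have /setP/(_ x) : ~: X = setT; last by rewrite !inE eqxx.
  apply: so; first by rewrite sub1set inE.
  apply/stableP => e b op; rewrite inE => /lth te.
  rewrite inE; apply/negP; rewrite inE => /eqP hd.
  by have := Hh e b; rewrite (negbTE op); lia.
have hc v : h v = h x by have := in_setT v; rewrite -XT inE => /eqP.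
apply/ffunP => e; have := Hh e true; have := Hh e false.
by rewrite !hc !subrr; case: (o e) (p e) => [[]|] [[]|].
Qed.

Lemma blocked_exit {G : mgraph} (o : porientation G) (S : {set vert G}) e b :
  stable (open_arc o) S -> tail e b \in S -> head e b \notin S ->
  o e = Some (~~ b).
Proof.
move=> /stableP oS te; apply: contraNeq => oe.
by apply: (oS e b).
Qed.

(** Reversing the cut around S leaves the arcs inside S alone and, S being stable
    for o, no traversable arc of o leaves S. *)
Lemma stable_reversal {G : mgraph} (o : porientation G) (S T : {set vert G}) :
  stable (open_arc o) S -> stable (open_arc (reverse_on o (cut (~: S)))) T ->
  stable (open_arc o) (T :&: S).
Proof.
move=> /stableP oS /stableP pT; apply/stableP => e b oe.
rewrite !inE => /andP[teT teS]; have heS := oS e b oe teS.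
rewrite heS andbT; apply: (pT e b) => //.
rewrite /open_arc ffunE; case: ifP => // /cutP[c []].
by rewrite !inE; case: b c teS heS {oe teT} => [] [];
  rewrite /head /tail /= => -> ->.
Qed.

(** The induction is on the size of a smallest stable set containing q, which
    plays the role of the set reached from q.  If S is such a set, reversing
    the cut around S opens arcs out of S, and by [stable_reversal] every set
    that is stable afterwards and contains q contains S strictly. *)
Lemma root_connected_exists {G : mgraph} (q : vert G) (o : porientation G) :
  spans (fun (e : edge G) _ => e \in setT) [set q] ->
  exists2 p, cut_equiv o p & spans (open_arc p) [set q].
Proof.
move=> conn; pose minimal (o : porientation G) k :=
  forall S : {set vert G}, q \in S -> stable (open_arc o) S -> (k <= #|S|)%N.
have : minimal o (#|vert G| - #|vert G|)%N by move=> S _ _; rewrite subnn.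
move: {2}#|vert G| => m; elim: m o => [|m IH] o mo.
  exists o; first exact: connect0.
  apply/spansP => S; rewrite sub1set => qS oS; apply/eqP.
  by rewrite eqEcard subsetT cardsT -[X in (X <= _)%N]subn0 mo.
have [so|/forallPn[S0]] := boolP (spans (open_arc o) [set q]).
  by exists o; first exact: connect0.
rewrite !negb_imply sub1set => /and3P[qS0 oS0 S0T].
pose P (S : {set vert G}) := [&& q \in S, stable (open_arc o) S & S != setT].
have PS0 : P S0 by apply/and3P.
have [S /and3P[qS oS ST] minS] := @arg_minnP _ S0 P (fun S => #|S|) PS0.
pose p := reverse_on o (cut (~: S)).
have op : cut_equiv o p.
  apply: connect1; apply/orP; left; apply/existsP; exists (~: S).
  rewrite eqxx andbT; apply/and3P; split.
  - by rewrite -setCT (inj_eq (can_inj (@setCK _))).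
  - by rewrite properE subsetT subTset -setC0 (inj_eq (can_inj (@setCK _)));
      apply/set0Pn; exists q.
  - apply/forall_inP => e /cutP[b []]; rewrite !inE negbK => te he.
    have := blocked_exit o S e (~~ b) oS; rewrite headN tailN => /(_ he te).
    by rewrite negbK /directed_from => ->; rewrite !inE te he.
have [p' pp' sp'] : exists2 p', cut_equiv p p' & spans (open_arc p') [set q].
  apply: IH => T qT pT; have oTS := stable_reversal _ _ _ oS pT.
  have STS : S \subset T :&: S.
    suff /eqP-> : T :&: S == S by [].
    rewrite eqEcard subsetIr minS //; apply/and3P; split => //.
      by rewrite inE qT.
    apply: contraNneq ST => TST; by rewrite -subTset -TST subsetIr.
  have ST' : S \proper T.
    rewrite properEneq (subset_trans STS) ?subsetIl // andbT.
    apply: contraNneq ST => EST; apply/eqP/(spansP conn); first by rewrite sub1set.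
    apply/stableP => e b _ te; apply/negPn/negP => he.
    have /negP[] := he; rewrite EST; apply: (stableP pT e b); last by rewrite -EST.
    rewrite /open_arc ffunE (blocked_exit _ _ _ _ oS te he) /=.
    case: ifP => [_|/negP[]]; first by case: (b).
    by apply/cutP; exists (~~ b); rewrite headN !inE te.
  have := proper_card ST'; have := mo S qS oS; lia.
by exists p' => //; apply: connect_trans op pp'.
Qed.

Lemma cut_equiv_sym {G : mgraph} (o p : porientation G) :
  cut_equiv o p = cut_equiv p o.
Proof. by apply: sym_connect_sym => x y; rewrite /= orbC. Qed.

Lemma card_cut_classes {G : mgraph} (q : vert G) :
  spans (fun (e : edge G) _ => e \in setT) [set q] ->
  #|cut_classes G| = #|[set o : porientation G | spans (open_arc o) [set q]]|.
Proof.
move=> conn; pose cls (o : porientation G) := [set p | cut_equiv o p].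
rewrite -(@card_in_imset _ _ cls) => [|o p]; last first.
  rewrite !inE => so sp /setP/(_ p); rewrite !inE [RHS]connect0.
  exact: root_connected_unique so sp.
apply: eq_card => C; apply/imsetP/imsetP => -[o oP ->].
  have [p op sp] := root_connected_exists q o conn; exists p; first by rewrite inE.
  apply/setP => r; rewrite !inE /=.
  exact: (same_connect cut_equiv_sym op).
by exists o => //; apply/setP => r; rewrite !inE.
Qed.

(** * The Tutte polynomial at x = 1 *)

Lemma adjacent_sym {G : mgraph} (A : {set edge G}) : symmetric (adjacent A).
Proof. by move=> u v; apply: eq_existsb => e; rewrite orbC. Qed.

Lemma spans_connect {G : mgraph} (A : {set edge G}) (q : vert G) :
  spans (fun e _ => e \in A) [set q] = [forall v, connect (adjacent A) q v].
Proof.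
apply/spansP/forallP => [H v|H S].
  suff /setP/(_ v) : [set u | connect (adjacent A) q u] = setT by rewrite !inE.
  apply: H; first by rewrite sub1set inE connect0.
  apply/stableP => e b eA; rewrite !inE => /connect_trans; apply.
  apply/connect1/exists_inP; exists e => //.
  by case: b; rewrite /head /tail /= -surjective_pairing eqxx ?orbT.
rewrite sub1set => qS /stableP AS; apply/setP => v; rewrite inE.
suff cl : closed (adjacent A) (mem S) by rewrite -(closed_connect cl (H v)).
apply: intro_closed => [|u w /exists_inP[e eA] /orP[] /eqP Ee uS].
- exact: (sym_connect_sym (adjacent_sym A)).
- by have := AS e false eA; rewrite /head /tail Ee; apply.
- by have := AS e true eA; rewrite /head /tail Ee; apply.
Qed.

Lemma n_comp_gt0 {G : mgraph} (A : {set edge G}) (q : vert G) :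
  (0 < n_comp (adjacent A) (vert G))%N.
Proof.
apply/card_gt0P; exists (fingraph.root (adjacent A) q).
by rewrite !inE (roots_root (sym_connect_sym (adjacent_sym A))).
Qed.

Lemma n_comp_spans {G : mgraph} (A : {set edge G}) (q : vert G) :
  (n_comp (adjacent A) (vert G) <= 1)%N = spans (fun e _ => e \in A) [set q].
Proof.
have cs := sym_connect_sym (adjacent_sym A).
rewrite spans_connect; apply/card_le1_eqP/forallP => [H v|H u v].
  by rewrite -(root_connect cs); apply/eqP/H; rewrite !inE roots_root.
rewrite !inE !andbT => /eqP <- /eqP <-; apply/eqP; rewrite (root_connect cs).
by rewrite (connect_trans _ (H u)) // cs H.
Qed.

Lemma tutte_evalE (G : mgraph) (x y : int) :
  tutte_eval G x y = \sum_(A : {set edge G})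
     (x - 1) ^+ (edge_rank [set: edge G] - edge_rank A)
     * (y - 1) ^+ (#|A| - edge_rank A).
Proof.
rewrite /tutte_eval /tutte !horner_sum; apply: eq_bigr => A _.
by rewrite !(hornerM, horner_exp, hornerD, hornerN, hornerC, hornerX).
Qed.

(** At x = 1 the factor 0 ^ (r(E) - r(A)) selects the connected spanning A, whose
    rank is |V| - 1; [card_spanning] ensures that the truncated exponent
    |A| - (|V| - 1) is an honest subtraction. *)
Lemma tutte_spanning {G : mgraph} (q : vert G) (y : int) :
  spans (fun (e : edge G) _ => e \in setT) [set q] ->
  (y - 1) ^+ (#|vert G| - 1) * tutte_eval G 1 y =
  \sum_(A : {set edge G} | spans (fun e _ => e \in A) [set q]) (y - 1) ^+ #|A|.
Proof.
move=> conn; rewrite tutte_evalE big_distrr [RHS]big_mkcond /=.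
apply: eq_bigr => A _; rewrite subrr expr0n.
have nT : n_comp (adjacent [set: edge G]) (vert G) = 1%N.
  by apply/eqP; rewrite eqn_leq (n_comp_spans _ q) conn n_comp_gt0.
have nV : (n_comp (adjacent A) (vert G) <= #|vert G|)%N by apply: max_card.
have := n_comp_gt0 A q; rewrite -n_comp_spans /edge_rank nT.
move=> n0; case: leqP => n1; last by rewrite gtn_eqF ?mul0r ?mulr0 //; lia.
have An : n_comp (adjacent A) (vert G) = 1%N by lia.
have := card_spanning A [set q].
rewrite -n_comp_spans An cardsC1 subnn mul1r -exprD => /(_ isT).
by rewrite subn1 => /subnKC->.
Qed.

Lemma card_support {E T : finType} (A : {set E}) :
  #|[set f : {ffun E -> option T} | [set e | f e != None] == A]|
  = (#|T| ^ #|A|)%N.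
Proof.
pose F e : pred (option T) := if e \in A then predC1 None else pred1 None.
rewrite -(card_family_const A F) => [|e]; last first.
  by rewrite /F; case: (e \in A); rewrite ?card1 ?cardC1 ?card_option.
apply: eq_card => f; rewrite inE.
apply/eqP/familyP => [EA e|H]; first by rewrite /F -EA inE; case: (f e).
apply/setP => e; have := H e; rewrite /F inE.
by case: (e \in A); case: (f e).
Qed.

Theorem theorem3p6 (G : mgraph) (hG : connected_graph G) :
  (#|cut_classes G|)%:Z = 2 ^+ (#|vert G| - 1)%N * tutte_eval G 1 3.
Proof.
have [/card_gt0P[q _] conn] := hG.
have sq : spans (fun (e : edge G) _ => e \in setT) [set q].
  by rewrite spans_connect; apply/forallP.
have {1}-> : 2%:R = 3%:R - 1 :> int by [].
rewrite (tutte_spanning q) // (card_cut_classes q) //.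
have [c Hc] := @card_explorations G (option bool) (fun=> 2%N) setT [set q].
have full (t : bool -> pred (option bool)) : (forall b, #|t b| = 2%N) ->
    #|[set o : porientation G | spans (fun e b => t b (o e)) [set q]]| = c.
  move=> tk; rewrite -(Hc t tk [ffun=> None]); apply: eq_card => o.
  rewrite !inE; symmetry; rewrite andb_idl => [|_].
    by apply: eq_spans => e b; rewrite inE.
  by apply/forallP => e; rewrite inE.
(* From traversing unoriented edges and outward arcs to traversing exactly the
   oriented edges: both rules let two of the three states pass. *)
rewrite (full (fun b => predC1 (Some (~~ b)))); last first.
  by move=> b; rewrite cardC1 card_option card_bool.
rewrite -(full (fun=> predC1 None)); last first.
  by move=> b; rewrite cardC1 card_option card_bool.
rewrite -sum1_card (partition_big (fun o : porientation G => [set e | o e != None])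
  (fun A : {set edge G} => spans (fun e _ => e \in A) [set q])) /=; last first.
  move=> o; rewrite inE; congr is_true; apply: eq_spans => e b.
  by rewrite inE.
rewrite -natz natr_sum; apply: eq_bigr => A sA.
rewrite sum1_card (_ : 3%:R - 1 = 2%:R) // -natrX -card_bool -card_support.
congr _%:R; apply: eq_card => o; rewrite [RHS]inE -topredE /= inE andb_idl //.
move=> /eqP oA; rewrite (@eq_spans _ _ (fun e _ => e \in A)) // => e b.
by rewrite -oA inE.
Qed.
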